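(* Let $A$ be a finite set with $|A|\ge 3$. A congruence lattice $\operatorname{Con}(A,f)$ with an acyclic $f\in A^A$ is meet-irreducible in $\mathcal{E}$ if and only if $f$ is of type (I) or of type (II) or satisfies condition (a) or condition (b), where these are defined as follows: (I) $f$ is nontrivial and $f^2=f$; (II) $f$ is nontrivial, $f^2$ is a constant mapping, say with value $c\in A$, and $|\{x\in A\mid f(x)=f(c)\}|\ge 3$; (a) there exist distinct elements $0,1,2,0',1',2'\in A$ such that $f(2)=1$, $f(1)=f(0)=0$ and $f(2')=1'$, $f(1')=f(0')=0'$; (b) $f$ is connected and there exist distinct elements $0,1,2,1',2'\in A$ such that $f(2)=1$, $f(2')=1'$, $f(1')=f(1)=f(0)=0$.
   Context: $\operatorname{Eq}(A)$ is the set of all equivalence relations on $A$. A mapping $f\colon A\to A$ preserves $\kappa\in\operatorname{Eq}(A)$ if $(x,y)\in\kappa$ implies $(f(x),f(y))\in\kappa$. For $F\subseteq A^A$, $\operatorname{Con}(A,F)$ is the set of all $\kappa\in\operatorname{Eq}(A)$ preserved by every $f\in F$, and $\operatorname{Con}(A,f):=\operatorname{Con}(A,\{f\})$. $\mathcal{E}:=\{\operatorname{Con}(A,F)\mid F\subseteq A^A\}$, ordered by inclusion; it is a lattice whose meet is intersection and whose greatest element is $\operatorname{Eq}(A)$. An element $m$ different from the greatest element is meet-irreducible if $m=a\wedge b$ implies $m=a$ or $m=b$. $f$ is trivial if it is the identity or a constant mapping, otherwise nontrivial. $f^n$ is the $n$-fold composition. $f$ is acyclic if it has no cycles of length greater than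 $1$, i.e. for each $x\in A$ there is $n\in\mathbb{N}$ with $f^n(x)=f^{n+1}(x)$. $f$ is connected if for all $x,y\in A$ there are $i,j\in\mathbb{N}$ with $f^i(x)=f^j(y)$. The symbols $0,1,2,0',1',2'$ in (a), (b) are just names of elements of $A$. *)

(* Defs.v *)
From mathcomp Require Import all_boot.

Set Implicit Arguments.
Unset Strict Implicit.
Unset Printing Implicit Defensive.

Section CongruenceLattices.

Variable A : finType.

(* Binary relations on A are represented by their graphs in A * A. *)
Definition is_equivalence (k : {set A * A}) : bool :=
  [&& [forall x, (x, x) \in k],
      [forall x, forall y, ((x, y) \in k) ==> ((y, x) \in k)]
    & [forall x, forall y, forall z,
         ((x, y) \in k) && ((y, z) \in k) ==> ((x, z) \in k)]].

Definition EqRel : {set {set A * A}} := [set k | is_equivalence k].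

Definition preserves (f : {ffun A -> A}) (k : {set A * A}) : bool :=
  [forall x, forall y, ((x, y) \in k) ==> ((f x, f y) \in k)].

Definition Con (F : {set {ffun A -> A}}) : {set {set A * A}} :=
  [set k in EqRel | [forall f in F, preserves f k]].

Definition Con1 (f : {ffun A -> A}) : {set {set A * A}} := Con [set f].

Definition lattE : {set {set {set A * A}}} :=
  [set Con F | F in [set: {set {ffun A -> A}}]].

(* The next three facts show that, for inclusion, EqRel is the greatest element of
   lattE and that the meet of two elements of lattE is their intersection. *)
Lemma lattE_EqRel : EqRel \in lattE.
Proof.
apply/imsetP; exists set0 => //; apply/setP=> k; rewrite [RHS]inE.
by case: (k \in EqRel) => //=; apply/esym/forall_inP=> f; rewrite inE.
Qed.

Lemma lattE_sub_EqRel a : a \in lattE -> a \subset EqRel.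
Proof. by case/imsetP=> F _ ->; apply/subsetP=> k; rewrite inE => /andP[]. Qed.

Lemma lattE_setI a b : a \in lattE -> b \in lattE -> a :&: b \in lattE.
Proof.
case/imsetP=> F _ -> /imsetP[G _ ->]; apply/imsetP; exists (F :|: G) => //.
apply/setP=> k; rewrite inE ![k \in Con _]inE.
case: (k \in EqRel) => //=; apply/andP/forall_inP => [[/forall_inP HF /forall_inP HG] f|H].
  by case/setUP; [apply: HF | apply: HG].
by split; apply/forall_inP=> f fF; apply: H; rewrite inE fF ?orbT.
Qed.

Definition meet_irreducible (m : {set {set A * A}}) : Prop :=
  [/\ m \in lattE, m != EqRel
    & forall a b, a \in lattE -> b \in lattE ->
        m = a :&: b -> m = a \/ m = b].

Definition trivial_map (f : {ffun A -> A}) : Prop :=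
  (forall x, f x = x) \/ (exists c, forall x, f x = c).

Definition acyclic (f : {ffun A -> A}) : Prop :=
  forall x, exists n, iter n f x = iter n.+1 f x.

Definition connected (f : {ffun A -> A}) : Prop :=
  forall x y, exists i j, iter i f x = iter j f y.

Definition type_I (f : {ffun A -> A}) : Prop :=
  ~ trivial_map f /\ forall x, iter 2 f x = f x.

Definition type_II (f : {ffun A -> A}) : Prop :=
  ~ trivial_map f /\
  exists c, (forall x, iter 2 f x = c) /\ 3 <= #|[set x | f x == f c]|.

(* x0, x1, x2, y0, y1, y2 stand for 0, 1, 2, 0', 1', 2'. *)
Definition cond_a (f : {ffun A -> A}) : Prop :=
  exists x0 x1 x2 y0 y1 y2 : A,
    [/\ uniq [:: x0; x1; x2; y0; y1; y2],
        [/\ f x2 = x1, f x1 = x0 & f x0 = x0]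
      & [/\ f y2 = y1, f y1 = y0 & f y0 = y0]].

(* x0, x1, x2, y1, y2 stand for 0, 1, 2, 1', 2'. *)
Definition cond_b (f : {ffun A -> A}) : Prop :=
  connected f /\
  exists x0 x1 x2 y1 y2 : A,
    [/\ uniq [:: x0; x1; x2; y1; y2],
        f x2 = x1, f y2 = y1
      & [/\ f y1 = x0, f x1 = x0 & f x0 = x0]].

End CongruenceLattices.

(* Main.v *)
Require Import Defs.
From mathcomp Require Import all_boot.

(** Write M(f) for the set of maps g with Con f included in Con g. Every element
    of the lattice is an intersection of lattices Con g, so Con f is
    meet-irreducible as soon as one equivalence k outside Con f is preserved by
    every g in M(f) with Con g different from Con f
    ([meet_irreducible_witness]), and it is not when two maps of M(f) with
    strictly larger lattices have Con f as the intersection of these lattices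
    ([meet_irreducible_split]).

    To see that the four conditions suffice, take for k an equivalence with a
    single nontrivial block, and let g in M(f) not preserve k. Suitable
    congruences of f, each with at most three nontrivial blocks, leave little
    room for g. The basic observation ([rigid_fiber]) is that on three elements
    with the same image under f, the map g is constant or the identity. For
    types I and II one finds that g is f, or one of a few variants of f with the
    same congruences, such as f followed by the exchange of its two values. In
    cases (a) and (b) the block of k lies on two chains q, p, o with f q = p and
    f p = f o = o; not preserving k forces g = f on the two chains.
    A point x whose orbit avoids p can then be compared with q: the congruence
    generated by (x, q) only allows f x and p as values of g x, and g x lies in
    the orbit of x. No orbit meets both chains in their middle points, so g = f
    ([eq_of_two_chains]).

    Conversely, suppose that f is not idempotent and that none of the
    conditions holds. The components of f are rooted trees. Either a single
    component has depth at least 2 and there are other components, or f is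
    connected and all points of depth at least 2 lie over the same point p
    of depth 1. In the first case Con f is the intersection of Con g1 and
    Con g2, where g1 is f on the deep component and g2 is f elsewhere, both
    extended by the root of the deep component
    ([one_deep_component_reducible]). In the second case, if the depth is at
    least 3, the two maps are f up to depth 2 and f^2 beyond, and the other
    way round ([single_branch_reducible]); if the depth is 2, failure of
    type II means that p is the only point of depth 1, and f is a
    composition of two idempotents with larger congruence lattices
    ([short_path_reducible]). *)

(** Case analysis over memberships in explicit lists. Trying congruence before
    each disjunction keeps the number of cases small. *)
Ltac elems := repeat match goal with
  | H : is_true (_ == _) |- _ => move/eqP: H => H
  | H : is_true (_ || _) |- _ => move/orP: H => H
  | H : is_true (_ \in cons _ _) |- _ => rewrite in_cons in H
  | H : is_true (_ \in nil) |- _ => by []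
  | H : is_true (@in_mem ?T _ _) |- _ =>
      lazymatch T with prod _ _ => fail | set_of _ => fail
      | _ => progress rewrite !inE in H end
  | H : is_true (_ && _) |- _ => move/andP: H => H
  | H : is_true (~~ (_ == _)) |- _ => move/eqP: H => H
  | H : is_true (~~ (_ || _)) |- _ => rewrite negb_or in H
  | H : is_true (~~ (_ \in cons _ _)) |- _ => rewrite in_cons in H
  | H : is_true (~~ (_ \in nil)) |- _ => clear H
  | H : is_true (uniq _) |- _ => progress rewrite /= in H
  | H : _ /\ _ |- _ => destruct H
  | H : and3 _ _ _ |- _ => destruct H
  | H : _ \/ _ |- _ => (try simple congruence); destruct H
  | H : or3 _ _ _ |- _ => (try simple congruence); destruct H
  | H : or4 _ _ _ _ |- _ => (try simple congruence); destruct H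
  end.

Ltac by_elems := intros; elems; simple congruence.

(** Alternatives that are irrelevant to the current goal would multiply the
    cases of [elems]. *)
Ltac forget := repeat match goal with
  | H : _ \/ _ |- _ => clear H
  | H : or3 _ _ _ |- _ => clear H
  | H : or4 _ _ _ _ |- _ => clear H
  end.

Ltac pick := first [left; repeat split; simple congruence
  | right; repeat split; simple congruence].

Ltac out := forget; apply/negP => ?; by_elems.

Ltac member := by rewrite !inE ?eqxx ?orbT.

(** Goals stating that f maps an explicit list into itself. *)
Ltac closed := let u := fresh "u" in let uD := fresh "uD" in
  forget; move=> u uD; elems; subst u;
  repeat match goal with E : _ = _ :> _ |- _ => rewrite E end; member.

Ltac distinct := rewrite /= !inE ?negb_or; do ?[apply/andP; split] => //;
  apply/eqP; simple congruence.

Section Theory.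

Set Implicit Arguments.
Unset Strict Implicit.

Variable A : finType.
Implicit Types (f g : {ffun A -> A}) (k : {set A * A}) (D : {pred A}).

(** * Equivalences, congruences and meet-irreducibility *)

Lemma EqRelP k :
  reflect [/\ forall x, (x, x) \in k,
              forall x y, (x, y) \in k -> (y, x) \in k
            & forall y x z, (x, y) \in k -> (y, z) \in k -> (x, z) \in k]
          (k \in EqRel A).
Proof.
rewrite inE; apply: (iffP and3P) => [[R S T]|[R S T]]; split.
- by move=> x; apply: (forallP R).
- by move=> x y; apply/implyP/(forallP (forallP S x)).
- move=> y x z xy yz; move/forallP/(_ x)/forallP/(_ y)/forallP/(_ z): T.
  by rewrite xy yz.
- by apply/forallP.
- by apply/'forall_forallP => x y; apply/implyP/S.
- apply/forallP=> x; apply/'forall_forallP => y z.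
  by apply/implyP => /andP[]; apply: T.
Qed.

Lemma Con1P f k :
  reflect (k \in EqRel A /\ forall x y, (x, y) \in k -> (f x, f y) \in k)
          (k \in Con1 f).
Proof.
apply: (iffP setIdP) => -[kE P]; split=> //.
  move=> x y; have /forallP/(_ x)/forallP/(_ y)/implyP := forall_inP P f (set11 f).
  exact.
apply/forall_inP=> _ /set1P->; apply/'forall_forallP => x y.
by apply/implyP/P.
Qed.

Lemma Con1_lattE f : Con1 f \in lattE A.
Proof. exact: imset_f. Qed.

Lemma mem_Con (F : {set {ffun A -> A}}) k :
  k \in EqRel A -> (forall g, g \in F -> k \in Con1 g) -> k \in Con F.
Proof.
move=> kE H; rewrite inE kE; apply/forall_inP=> g gF.
have /Con1P[_ P] := H g gF.
by apply/'forall_forallP => x y; apply/implyP/P.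
Qed.

Lemma Con_sub (F : {set {ffun A -> A}}) g : g \in F -> Con F \subset Con1 g.
Proof.
move=> gF; apply/subsetP=> k; rewrite !inE => /andP[-> /forall_inP P] /=.
by apply/forall_inP=> _ /set1P->; apply: P.
Qed.

(** If Con f is the intersection of Con F and Con G and neither equals Con f,
    then no map of F or G has its congruences inside Con f, so all of them
    preserve k. Then k lies in the intersection, that is, in Con f. *)
Lemma meet_irreducible_witness f k :
    k \in EqRel A -> k \notin Con1 f ->
    (forall g, Con1 f \subset Con1 g ->
       k \in Con1 g \/ Con1 g \subset Con1 f) ->
  meet_irreducible (Con1 f).
Proof.
move=> kE kf H; split; first exact: Con1_lattE.
  by apply: contraNneq kf => ->.
have main a : a \in lattE A -> Con1 f \subset a -> Con1 f = a \/ k \in a.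
  case/imsetP=> F _ ->{a} sub.
  have [/exists_inP[g gF gf]|none] := boolP [exists g in F, Con1 g \subset Con1 f].
    left; apply/eqP; rewrite eqEsubset sub.
    exact: subset_trans (Con_sub gF) gf.
  right; apply: mem_Con => // g gF.
  case: (H g) => //; first exact: subset_trans sub (Con_sub gF).
  by move=> gf; case/exists_inP: none; exists g.
move=> a b aE bE E.
case: (main a aE); [by rewrite E subsetIl | by left | move=> ka].
case: (main b bE); [by rewrite E subsetIr | by right | move=> kb].
by rewrite E inE ka kb in kf.
Qed.

Lemma meet_irreducible_split f g1 g2 k1 k2 :
    meet_irreducible (Con1 f) ->
    Con1 f \subset Con1 g1 -> Con1 f \subset Con1 g2 ->
    Con1 g1 :&: Con1 g2 \subset Con1 f ->
    k1 \in Con1 g1 -> k1 \notin Con1 f ->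
    k2 \in Con1 g2 -> k2 \notin Con1 f ->
  False.
Proof.
case=> _ _ irr s1 s2 s k1g k1f k2g k2f.
have E : Con1 f = Con1 g1 :&: Con1 g2.
  by apply/eqP; rewrite eqEsubset subsetI s1 s2.
case: (irr _ _ (Con1_lattE g1) (Con1_lattE g2) E) => Ef.
  by rewrite Ef k1g in k1f.
by rewrite Ef k2g in k2f.
Qed.

Lemma meet_irreducible_nontrivial f :
  meet_irreducible (Con1 f) -> ~ trivial_map f.
Proof.
case=> _ /eqP nE _ tf; apply: nE; apply/setP=> k.
apply/Con1P/idP=> [[]//|kE]; split=> // x y kxy.
have /EqRelP[R _ _] := kE.
by case: tf => [fid|[c fc]]; rewrite ?fid ?fc.
Qed.

Lemma Con1_iter f k : k \in Con1 f ->
  forall n x y, (x, y) \in k -> (iter n f x, iter n f y) \in k.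
Proof. by case/Con1P=> _ P; elim=> //= n IH x y /IH/P. Qed.

Lemma Con1_subI f g1 g2 :
  (forall k, k \in EqRel A ->
     (forall x y, (x, y) \in k -> (g1 x, g1 y) \in k) ->
     (forall x y, (x, y) \in k -> (g2 x, g2 y) \in k) ->
     forall x y, (x, y) \in k -> (f x, f y) \in k) ->
  Con1 g1 :&: Con1 g2 \subset Con1 f.
Proof.
move=> H; apply/subsetP=> k /setIP[/Con1P[kE P1] /Con1P[_ P2]].
by apply/Con1P; split=> //; apply: H.
Qed.

Lemma Con1_sub f g :
  (forall k, k \in EqRel A ->
     (forall x y, (x, y) \in k -> (f x, f y) \in k) ->
     forall x y, (x, y) \in k -> (g x, g y) \in k) ->
  Con1 f \subset Con1 g.
Proof.
move=> H; apply/subsetP=> k /Con1P[kE P]; apply/Con1P; split=> //; exact: H.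
Qed.

(** * Equivalences with prescribed blocks *)

(** The nontrivial blocks are the level sets of the positive values of l; points
    with label 0 are singletons. Disjointness of the blocks comes for free. *)
Definition blocks (l : A -> nat) : {set A * A} :=
  [set u | (u.1 == u.2) || (l u.1 == l u.2) && (0 < l u.1)].

Lemma blocks_EqRel l : blocks l \in EqRel A.
Proof.
apply/EqRelP; split=> [x|x y|y x z]; rewrite !inE /=.
- by rewrite eqxx.
- case/orP=> [/eqP->|/andP[/eqP E p]]; first by rewrite eqxx.
  by rewrite -E p eqxx orbT.
case/orP=> [/eqP->//|/andP[/eqP E p]].
case/orP=> [/eqP<-|/andP[/eqP E' _]]; first by rewrite E eqxx -E p orbT.
by rewrite E E' eqxx -E' -E p orbT.
Qed.

Lemma blocksP l x y :
  reflect (x = y \/ l x = l y /\ 0 < l x) ((x, y) \in blocks l).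
Proof.
rewrite inE; apply: (iffP orP) => -[/eqP|]; rewrite /=.
- by left.
- by case/andP=> /eqP; right.
- by left.
- by case=> -> ->; right; rewrite eqxx.
Qed.

Lemma blocks_Con1 f l :
    (forall x y, l x = l y -> 0 < l x -> (f x, f y) \in blocks l) ->
  blocks l \in Con1 f.
Proof.
move=> H; apply/Con1P; split=> [|x y]; first exact: blocks_EqRel.
case/blocksP=> [->|[E p]]; last exact: H.
by apply/blocksP; left.
Qed.

Definition block (s : seq A) := blocks (fun u => u \in s).

Lemma block_EqRel s : block s \in EqRel A.
Proof. exact: blocks_EqRel. Qed.

Lemma blockP s u v :
  reflect (u = v \/ u \in s /\ v \in s) ((u, v) \in block s).
Proof.
apply: (iffP (blocksP _ _ _)) => -[]; try by left.
  by case=> E p; right; move: E p; case: (u \in _); case: (v \in _).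
by case=> -> ->; right.
Qed.

Lemma block_Con1 f x s :
  reflect (forall u, u \in s -> (f x, f u) \in block (x :: s))
          (block (x :: s) \in Con1 f).
Proof.
have /EqRelP[R S T] := block_EqRel (x :: s).
apply: (iffP idP) => [/Con1P[_ P] u us|P].
  by apply/P/blockP; rewrite !inE eqxx us orbT; right.
have {}P u : u \in x :: s -> (f x, f u) \in block (x :: s).
  by rewrite inE => /predU1P[->|/P].
apply/Con1P; split=> [|u v /blockP[->|[us vs]]]; [exact: block_EqRel | exact: R |].
by apply: (T (f x)); [apply: S|]; apply: P.
Qed.

Lemma block2_Con1 f x y :
  (block [:: x; y] \in Con1 f) = ((f x, f y) \in block [:: x; y]).
Proof.
apply/block_Con1/idP => [|H u]; first by apply; rewrite inE.
by rewrite inE => /eqP->.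
Qed.

Section Transfer.

Variables f g : {ffun A -> A}.
Hypothesis fg : Con1 f \subset Con1 g.

Lemma blocks_transfer l x y :
    (forall x y, l x = l y -> 0 < l x -> (f x, f y) \in blocks l) ->
    l x = l y -> 0 < l x ->
  g x = g y \/ l (g x) = l (g y) /\ 0 < l (g x).
Proof.
move=> /blocks_Con1/(subsetP fg)/Con1P[_ P] E p.
by apply/blocksP/P/blocksP; right.
Qed.

Lemma transfer_fiber x y : f x = f y ->
  g x = g y \/ g x \in [:: x; y] /\ g y \in [:: x; y].
Proof.
move=> E; apply/blockP; rewrite -block2_Con1.
by apply: (subsetP fg); rewrite block2_Con1; apply/blockP; left.
Qed.

(** The blocks used below are sets D mapped into themselves by f, which can be
    collapsed, together with a pair whose image is collapsed, and so on. *)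
Lemma transfer_ideal D x y :
    {in D, forall u, f u \in D} -> x \in D -> y \in D ->
  g x = g y \/ g x \in D /\ g y \in D.
Proof.
move=> DD xD yD; pose l u : nat := u \in D.
case: (@blocks_transfer l x y); rewrite /l ?xD ?yD //; last 2 first.
- by left.
- by case=> E p; right; move: E p; case: (g x \in D); case: (g y \in D).
move=> u v E p; apply/blocksP; right.
have uD : u \in D by move: p; case: (u \in _).
have vD : v \in D by move: E; rewrite uD; case: (v \in _).
by rewrite !DD.
Qed.

Lemma transfer_pair D x y :
    {in D, forall u, f u \in D} ->
    x \notin D -> y \notin D -> f x \in D -> f y \in D ->
  [\/ g x = g y, g x \in [:: x; y] /\ g y \in [:: x; y]
    | g x \in D /\ g y \in D].
Proof.
move=> DD xD yD fxD fyD.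
pose l u := if u \in D then 1 else if u \in [:: x; y] then 2 else 0.
have lx : l x = 2 by rewrite /l (negPf xD) mem_head.
have ly : l y = 2 by rewrite /l (negPf yD) !inE eqxx orbT.
case: (@blocks_transfer l x y); rewrite ?lx ?ly //.
- move=> u v; rewrite /l.
  have [uD|_] := boolP (u \in D); last have [uxy|//] := boolP (u \in [:: x; y]);
  (have [vD|_] := boolP (v \in D); last have [vxy|//] := boolP (v \in [:: x; y])) =>
    // _ _; apply/blocksP; right; rewrite /l.
    by rewrite !DD.
  have -> : f u \in D by by_elems.
  have -> : f v \in D by by_elems.
  by [].
- by constructor 1.
- rewrite /l; case=> E p; move: E p.
  have [uD|_] := boolP (g x \in D); last have [uxy|//] := boolP (g x \in [:: x; y]);
  (have [vD|_] := boolP (g y \in D); last have [vxy|//] := boolP (g y \in [:: x; y])) =>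
    // _ _; by [constructor 2 | constructor 3].
Qed.

Lemma transfer_two_pairs D x y :
    {in D, forall u, f u \in D} ->
    f x \notin D -> f y \notin D -> f (f x) \in D -> f (f y) \in D ->
    x \notin D -> y \notin D ->
    x \notin [:: f x; f y] -> y \notin [:: f x; f y] ->
  [\/ g x = g y, g x \in [:: x; y] /\ g y \in [:: x; y],
      g x \in [:: f x; f y] /\ g y \in [:: f x; f y]
    | g x \in D /\ g y \in D].
Proof.
move=> DD fxD fyD ffxD ffyD xD yD xf yf.
pose l u := if u \in D then 1 else if u \in [:: f x; f y] then 2
            else if u \in [:: x; y] then 3 else 0.
have lx : l x = 3 by rewrite /l (negPf xD) (negPf xf) mem_head.
have ly : l y = 3 by rewrite /l (negPf yD) (negPf yf) !inE eqxx orbT.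
case: (@blocks_transfer l x y); rewrite ?lx ?ly //.
- move=> u v; rewrite /l.
  have [uD|_] := boolP (u \in D);
    last (have [uf|_] := boolP (u \in [:: f x; f y]);
      last have [ux|//] := boolP (u \in [:: x; y]));
  (have [vD|_] := boolP (v \in D);
    last (have [vf|_] := boolP (v \in [:: f x; f y]);
      last have [vx|//] := boolP (v \in [:: x; y]))) =>
    // _ _; apply/blocksP; right; rewrite /l.
  + by rewrite !DD.
  + have -> : f u \in D by by_elems.
    have -> : f v \in D by by_elems.
    by [].
  + have fz w : w \in [:: x; y] ->
        (f w \in D) = false /\ f w \in [:: f x; f y].
      rewrite !inE => /orP[] /eqP->; rewrite eqxx ?orbT; split=> //;
      exact: negPf.
    by case: (fz _ ux) (fz _ vx) => -> -> [-> ->].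
- by constructor 1.
- rewrite /l; case=> E p; move: E p.
  have [uD|_] := boolP (g x \in D);
    last (have [uf|_] := boolP (g x \in [:: f x; f y]);
      last have [ux|//] := boolP (g x \in [:: x; y]));
  (have [vD|_] := boolP (g y \in D);
    last (have [vf|_] := boolP (g y \in [:: f x; f y]);
      last have [vx|//] := boolP (g y \in [:: x; y]))) =>
    // _ _; by [constructor 2 | constructor 3 | constructor 4].
Qed.


(** * Rigidity on small depths *)

(** If g moves p, then it maps each of the pairs of p with q and r either to one
    point or onto itself, and the third pair forces a single value. *)
Lemma rigid_fiber p q r : p <> q -> p <> r -> q <> r ->
    f p = f q -> f p = f r ->
  [/\ g p = p, g q = q & g r = r] \/ g q = g p /\ g r = g p.
Proof.
move=> pq pr qr fpq fpr.
have := transfer_fiber fpq; have := transfer_fiber fpr.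
have := @transfer_fiber q r; rewrite -fpq => /(_ fpr) H1 H2 H3.
have [?|?] := eqVneq (g p) p; last have [?|?] := eqVneq (g p) q;
  elems; by [pick | simple congruence].
Qed.

Section DepthTwo.

Variables c p z d : A.
Hypotheses (fc : f c = c) (fp : f p = c) (fz : f z = p) (fd : f d = c).
Hypotheses (pc : p <> c) (dc : d <> c) (dp : d <> p).

(** The situation throughout: a chain z, p, c ending at the fixed point c, and a
    further point d of depth 1, against which z can be compared. *)
Lemma rigid_depth1 :
  [/\ g c = c, g p = p & g d = d] \/ g p = g c /\ g d = g c.
Proof. by apply: rigid_fiber; rewrite ?fc ?fp ?fd //; apply: not_eq_sym. Qed.

Lemma transfer_depth2 :
  [\/ g z = g d, g z \in [:: z; d] /\ g d \in [:: z; d]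
    | g z \in [:: c; p] /\ g d \in [:: c; p]].
Proof.
apply: transfer_pair; try by out.
- by closed.
- by rewrite fz !inE eqxx orbT.
- by rewrite fd !inE eqxx.
Qed.

Lemma transfer_chain2 : g z = g c \/ g z \in [:: c; p; z] /\ g c \in [:: c; p; z].
Proof. by apply: transfer_ideal; [closed | member | member]. Qed.

Lemma depth2_id : g c = c -> g d = d -> g z = z.
Proof.
move=> gc gd; have := transfer_depth2; have := transfer_chain2.
by rewrite gc gd => *; by_elems.
Qed.

Lemma depth2_const : g d = g c ->
  g z = g c \/ g z \in [:: c; p] /\ g c \in [:: c; p].
Proof.
move=> gd; have := transfer_depth2; have := transfer_chain2; rewrite gd => H1 H2.
have [E|gz] := eqVneq (g z) (g c); first by left.
move/eqP in gz; elems; try simple congruence; right; split; rewrite !inE; apply/orP;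
  by first [left; apply/eqP; simple congruence | right; apply/eqP; simple congruence].
Qed.

End DepthTwo.

Lemma transfer_depth2_pair c p z p' z' :
    f c = c -> f p = c -> f z = p -> f p' = c -> f z' = p' ->
    p <> c -> p' <> c ->
  [\/ g z = g z', g z \in [:: z; z'] /\ g z' \in [:: z; z']
    | g z \in [:: p; p'] /\ g z' \in [:: p; p']].
Proof.
move=> fc fp fz fp' fz' pc p'c; have := @transfer_two_pairs (pred1 c) z z'.
rewrite fz fz' fp fp'; case; try by [closed | member | out].
- by constructor 1.
- by constructor 2.
- by constructor 3.
by constructor 1; by_elems.
Qed.

(** Here g is f followed by the exchange of its two values a and b. *)
Lemma swap_sub a b :
    (forall y, f y = a /\ g y = b \/ f y = b /\ g y = a) ->
  Con1 g \subset Con1 f.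
Proof.
move=> H; apply: Con1_sub => k /EqRelP[R S _] P x y /P.
by case: (H x) => -[-> ->]; case: (H y) => -[-> ->] //; apply: S.
Qed.

End Transfer.

(** * Type I *)

(** With x not fixed, r = f x and s another fixed point, the pair x, s is the
    witness. The pairs x, r and r, s and the triple x, r, s are blocks of
    congruences; a map g that does not preserve the pair x, s thus acts on the
    triple in one of four ways, and each of them determines g. *)
Lemma type_I_meet_irreducible f : type_I f -> meet_irreducible (Con1 f).
Proof.
case=> nt ff'; have ff x : f (f x) = f x by apply: ff'.
have [/forallP H|] := boolP [forall x, f x == x].
  by case: nt; left=> x; apply/eqP.
rewrite negb_forall => /existsP[x /eqP fx].
have [/forallP H|] := boolP [forall s, f s == f x].
  by case: nt; right; exists (f x) => s; apply/eqP.
rewrite negb_forall => /existsP[s' /eqP sr'].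
have [r [s [[fxr fr fs] [sr xr xs]]]] :
    exists r s, [/\ f x = r, f r = r & f s = s] /\ [/\ s <> r, x <> r & x <> s].
  by exists (f x), (f s'); rewrite !ff; split; split=> // E; simple congruence.
apply: (@meet_irreducible_witness _ (block [:: x; s])).
- exact: blocks_EqRel.
- rewrite block2_Con1 fxr fs; apply/blockP=> ?; by_elems.
move=> g fg.
have roots t u : f t = t -> f u = u ->
    g t = g u \/ g t \in [:: t; u] /\ g u \in [:: t; u].
  by move=> ft fu; apply: (transfer_ideal fg); [closed | member | member].
have fibre y : g y = g (f y) \/ g y \in [:: y; f y] /\ g (f y) \in [:: y; f y].
  by apply: (transfer_fiber fg); rewrite ff.
have cross y z : f y <> y -> f z <> z ->
    [\/ g y = g z, g y \in [:: y; z] /\ g z \in [:: y; z]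
      | g y \in [:: f y; f z] /\ g z \in [:: f y; f z]].
  move=> fy fz; apply: (transfer_pair fg); try member.
  - by move=> u uD; elems; subst u; rewrite ff; member.
  - by apply/negP=> yD; apply: fy; elems; simple congruence.
  - by apply/negP=> zD; apply: fz; elems; simple congruence.
have [kg|kg] := boolP (block [:: x; s] \in Con1 g); [by left | right].
have gxs : g x <> g s.
  by move=> E; case/negP: kg; rewrite block2_Con1; apply/blockP; left.
have gxs2 : ~ (g x \in [:: x; s] /\ g s \in [:: x; s]).
  by move=> E; case/negP: kg; rewrite block2_Con1; apply/blockP; right.
have cases : [\/ [/\ g x = r, g r = r & g s = s], [/\ g x = s, g r = s & g s = r],
   [/\ g x = x, g r = r & g s = r] | [/\ g x = r, g r = x & g s = x]].
  have grs : g r = g s \/ g r = r /\ g s = s \/ g r = s /\ g s = r.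
    by have := roots r s fr fs => ?; elems; auto; left; simple congruence.
  have gxr : g x = g r \/ g x = x /\ g r = r \/ g x = r /\ g r = x.
    by have := fibre x; rewrite fxr => ?; elems; auto; left; simple congruence.
  case: gxr grs => [E|[[E E']|[E E']]] [F|[[F F']|[F F']]]; try simple congruence.
  - by constructor 1; split; simple congruence.
  - by constructor 2; split; simple congruence.
  - by constructor 3; split; simple congruence.
  - by case: gxs2; rewrite E F'; split; member.
  - by constructor 4; split; simple congruence.
case: cases => -[gx gr gs].
(* g agrees with f on the triple, and then everywhere. *)
- suff -> : g = f by [].
  apply/ffunP=> y; have [/eqP fy|/eqP fy] := boolP (f y == y).
    by have := roots r y fr fy; have := roots s y fs fy; rewrite gr gs fy; by_elems.
  have := fibre y; have := cross x y.
  have := roots r (f y) fr (ff y); have := roots s (f y) fs (ff y).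
  rewrite gr gs gx fxr => H1 H2 /(_ _ fy) => H3 H4.
  have {}H3 := H3 (not_eq_sym xr).
  by_elems.
(* Only two fixed points are possible, and g is f followed by their exchange. *)
- apply: (@swap_sub _ _ r s) => y.
  have rs t : f t = t -> t = r \/ t = s.
    move=> ft; have := roots r t fr ft; have := roots s t fs ft.
    rewrite gr gs => *.
    have [|/eqP] := eqVneq t r; [by left | right; by_elems].
  have := fibre y; have := rs (f y) (ff y) => H1 H2.
  have [/eqP fy|/eqP fy] := boolP (f y == y).
    by elems; pick.
  by elems; pick.
(* All points that f moves lie over r; g is the identity there and sends the
   other points to r. *)
- have H y : f y = r /\ g y = y \/ f y = y /\ g y = r.
    have rt t : f t = t -> g t = r.
      by move=> ft; have := roots s t fs ft; have := roots r t fr ft;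
        rewrite gs gr; by_elems.
    have [/eqP fy|/eqP fy] := boolP (f y == y); first by right; auto.
    have := fibre y; have := cross x y; rewrite fxr gx (rt (f y)) // => H1 H2.
    have {}H1 := H1 (not_eq_sym xr) fy.
    left; split; by_elems.
  apply: Con1_sub => k /EqRelP[R S T] P y z yz; move: (P y z yz).
  case: (H y) => -[-> ->]; case: (H z) => -[-> ->] // H'.
    exact: T _ _ _ (S _ _ H') yz.
  exact: T _ _ _ yz (S _ _ H').
(* The point x is the only one that f moves; g exchanges x and r and sends the
   other points to x. *)
- have H y : y = x \/ f y = y /\ g y = x.
    have rt t : f t = t -> g t = x.
      by move=> ft; have := roots s t fs ft; have := roots r t fr ft;
        rewrite gs gr; by_elems.
    have [/eqP fy|/eqP fy] := boolP (f y == y); first by right; auto.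
    have := fibre y; have := cross x y; rewrite fxr gx (rt (f y)) // => H1 H2.
    have {}H1 := H1 (not_eq_sym xr) fy.
    by left; by_elems.
  apply: Con1_sub => k /EqRelP[R S T] P y z; move: (P y z).
  case: (H y) => [->|[-> ->]]; case: (H z) => [->|[-> ->]] //;
    rewrite ?fxr ?gx // => H' yz; have {}H' := H' yz.
  + exact: T _ _ _ H' yz.
  + exact: T _ _ _ yz H'.
Qed.


(** * Type II *)

(** The witness is the pair z, p of a point z of depth 2 and its image p. A third
    point d of the fibre of c makes g the identity or a constant on that
    fibre. The identity would extend to z; when g is constant, the pairs of
    depth 2 leave only f and f followed by the exchange of c and p. *)
Lemma type_II_meet_irreducible f : type_II f -> meet_irreducible (Con1 f).
Proof.
case=> nt [c [ff' ge3]]; have ff x : f (f x) = c by apply: ff'.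
have fc : f c = c by rewrite -[in LHS](ff (f c)) ff.
have [/forallP H|] := boolP [forall s, f s == c].
  by case: nt; right; exists c => s; apply/eqP.
rewrite negb_forall => /existsP[z /eqP fz].
have [p fzp] : exists p, f z = p by exists (f z).
have pc : p <> c by congruence.
have fp : f p = c by rewrite -fzp ff.
have [d [fd dc dp]] : exists d, [/\ f d = c, d <> c & d <> p].
  have : 0 < #|[set x | f x == f c] :\: [set c; p]|.
    rewrite cardsD subn_gt0; apply: leq_ltn_trans ge3.
    by rewrite (leq_trans (subset_leq_card (subsetIr _ _))) // cards2; case: (_ != _).
  case/card_gt0P=> d; rewrite !inE negb_or fc => /andP[/andP[/eqP dc /eqP dp] /eqP fd].
  by exists d.
have zp : z <> p by congruence.
have zc : z <> c by congruence.
apply: (@meet_irreducible_witness _ (block [:: z; p])).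
- exact: blocks_EqRel.
- by rewrite block2_Con1 fp fzp; apply/blockP=> ?; by_elems.
move=> g fg.
have [kg|kg] := boolP (block [:: z; p] \in Con1 g); [by left | right].
have {}kg : g z <> g p /\ ~ (g z = z /\ g p = p).
  rewrite block2_Con1 in kg; split=> [E|[E E']]; case/blockP: kg.
    by left.
  by right; rewrite E E'; split; member.
case: kg => gzp gzpid.
have other x : f x <> c -> exists d', [/\ f d' = c, d' <> c & d' <> f x].
  have [E|/eqP ne] := eqVneq p (f x); first by exists d; rewrite -E.
  by exists p.
case: (rigid_depth1 fg fc fp fd pc dc dp) => [[gc gp gd]|[gp gd]].
  by case: gzpid; split=> //; apply: (depth2_id fg fc fp fzp fd).
have depth1 y : f y = c -> g y = g c.
  have [->//|/eqP yc] := eqVneq y c; have [->//|/eqP yp fy] := eqVneq y p.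
  by case: (rigid_depth1 fg fc fp fy pc yc yp) => [[gc gp' _]|[]]; simple congruence.
have depth2 x : f x <> c -> g x = g c \/ g x \in [:: c; f x] /\ g c \in [:: c; f x].
  move=> fx; have [d' [fd' dc' dp']] := other x fx.
  exact: (depth2_const fg fc (ff x) erefl fd' fx dc' dp' (depth1 _ fd')).
have two x (fx : f x <> c) :=
  transfer_depth2_pair fg fc fp fzp (ff x) erefl pc fx.
have : g c = c /\ g z = p \/ g c = p /\ g z = c.
  by have := depth2 z fz; rewrite fzp => H; elems; pick.
case=> -[gc gz].
  suff -> : g = f by [].
  apply/ffunP=> y; have [/eqP fy|/eqP fy] := boolP (f y == c).
    by rewrite depth1 // fy.
  have := depth2 y fy; have := two y fy; rewrite gc gz; by_elems.
apply: (@swap_sub _ _ c p) => y; have [/eqP fy|/eqP fy] := boolP (f y == c).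
  by left; rewrite depth1.
right; have := depth2 y fy; have := two y fy; rewrite gc gz => *.
split; by_elems.
Qed.


(** * Conditions (a) and (b) *)

Lemma fconnect_fixed f x y : f x = x -> fconnect f x y -> y = x.
Proof. by move=> fx /iter_findex <-; rewrite iter_fix. Qed.

Lemma fconnect_image f x y : fconnect f x y -> y = x \/ fconnect f (f x) y.
Proof.
move/iter_findex; case: (findex f x y) => [<-|n]; first by left.
by rewrite iterSr => <-; right; apply: fconnect_iter.
Qed.

Lemma fconnect_total f x y z :
  fconnect f x y -> fconnect f x z -> fconnect f y z \/ fconnect f z y.
Proof.
move=> /iter_findex <- /iter_findex <-.
case: (leqP (findex f x y) (findex f x z)) => [|/ltnW] /subnK <-; rewrite iterD.
  by left; apply: fconnect_iter.
by right; apply: fconnect_iter.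
Qed.

Lemma fconnect_closed f x : {in fconnect f x, forall u, f u \in fconnect f x}.
Proof. by move=> u xu; apply: connect_trans xu (fconnect1 f u). Qed.

Lemma acyclic_root f : acyclic f -> forall x, exists2 r, f r = r & fconnect f x r.
Proof. by move=> ac x; have [n E] := ac x; exists (iter n f x); rewrite ?fconnect_iter. Qed.

(** Going n times around the cycle through x passes the iterate at which the
    orbit of x becomes stationary. *)
Lemma acyclic_return f : acyclic f -> forall x, fconnect f (f x) x -> f x = x.
Proof.
move=> ac x /iter_findex; move: (findex _ _ _) => i; rewrite -iterSr => E.
have [n fixn] := ac x.
have periodic m : iter (m * i.+1) f x = x.
  by elim: m => [|m IH] //; rewrite mulSn iterD IH.
have := periodic n; rewrite mulnS addnC iterD iter_fix; last exact/esym/fixn.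
by move=> xE; have := fixn; rewrite /= xE => <-.
Qed.

Section Chains.

Variables f g : {ffun A -> A}.
Hypotheses (ac : acyclic f) (fg : Con1 f \subset Con1 g).
Hypothesis gfix : forall r, f r = r -> g r = r.

(** The forward orbit of x can be collapsed to its root, which g fixes. *)
Lemma transfer_orbit x : fconnect f x (g x).
Proof.
have [r fr xr] := acyclic_root ac x.
case: (@transfer_ideal _ _ fg (fconnect f x) x r); rewrite ?(gfix fr) //.
- exact: fconnect_closed.
- exact: connect0.
- by move->.
- by case.
Qed.

(** The point x is compared with q. The congruence generated by the pair x, q
    has the blocks x, q and f x, p and one block containing the higher iterates
    of x and o. As g q = p, the value g x is f x or p, and p is not in the orbit
    of x. If f x is already fixed, p takes the role of q. *)
Lemma eq_at_of_chain o p q x :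
    f o = o -> f p = o -> f q = p -> p <> o -> g q = p -> g p = o ->
    ~~ fconnect f x p ->
  g x = f x.
Proof.
move=> fo fp fq po gq gp xp; have xgx := transfer_orbit x.
have [/eqP fx|/eqP fx] := boolP (f x == x); first by rewrite gfix.
have xNp : x <> p by move=> E; rewrite E connect0 in xp.
have fxNp : f x <> p by move=> E; rewrite -E fconnect1 in xp.
have [/eqP ffx|/eqP ffx] := boolP (f (f x) == f x).
  have fxo : fconnect f x o -> o = f x.
    case/fconnect_image=> [E|]; [congruence | exact: fconnect_fixed].
  have H : [\/ g x = g p, g x \in [:: x; p] /\ g p \in [:: x; p]
      | g x \in [:: f x; o] /\ g p \in [:: f x; o]].
    by apply: (transfer_pair fg); [closed | out | out | member | rewrite fp; member].
  have {}fxo : g x = o -> o = f x by move=> E; apply: fxo; rewrite -E.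
  have [/eqP E|/eqP E] := boolP (g x == o); first by rewrite E fxo.
  rewrite gp in H; by_elems.
(* The point o need not lie in the orbit of x, hence the second clause. *)
pose D : {pred A} := [pred u | fconnect f (f (f x)) u || (u == o)].
have xNo : x <> o by congruence.
have fxNo : f x <> o by congruence.
have up y : fconnect f (f (f x)) y -> fconnect f (f x) y.
  exact/connect_trans/fconnect1.
have H : [\/ g x = g q, g x \in [:: x; q] /\ g q \in [:: x; q],
      g x \in [:: f x; f q] /\ g q \in [:: f x; f q] | g x \in D /\ g q \in D].
  apply: (transfer_two_pairs fg); rewrite ?fq ?fp ?inE; try out.
  - move=> u; rewrite !inE => /orP[/fconnect_closed E|/eqP->].
      by apply/orP; left.
    by rewrite fo eqxx orbT.
  - by apply/norP; split; [apply/negP=> /(acyclic_return ac) | exact/eqP].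
  - apply/norP; split; last exact/eqP.
    by apply: contra xp => /up; apply/connect_trans/fconnect1.
  - by rewrite connect0.
  - by rewrite eqxx orbT.
  - apply/norP; split; last exact/eqP.
    by apply/negP=> /up /(acyclic_return ac).
  - apply/norP; split; last by apply/eqP; congruence.
    apply: contra xp => /up E; rewrite -fq.
    by apply/fconnect_closed/(connect_trans (fconnect1 _ _) E).
  - apply/norP; split; apply/eqP; last by congruence.
    move=> E; case/negP: xp; rewrite -fq E; apply/fconnect_closed/fconnect1.
have gxp : g x <> p by move=> E; rewrite -E xgx in xp.
have pD : p \in D -> False.
  rewrite inE => /orP[/up E|/eqP//]; case/negP: xp.
  exact: connect_trans (fconnect1 _ _) E.
have qp : q <> p by congruence.
rewrite gq in H; case: H => [//|[_ H]|[H _]|[_ /pD]//]; by_elems.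
Qed.

(** At least one of the two chains can be used at each point: if p and p' were in
    the same orbit, one of them would be above the other. *)
Lemma eq_of_two_chains o p q o' p' q' :
    f o = o -> f p = o -> f q = p -> p <> o -> g q = p -> g p = o ->
    f o' = o' -> f p' = o' -> f q' = p' -> p' <> o' -> g q' = p' -> g p' = o' ->
    p <> p' -> p <> o' -> p' <> o ->
  g = f.
Proof.
move=> fo fp fq po gq gp fo' fp' fq' po' gq' gp' pp' po'' p'o.
apply/ffunP=> x.
have [xp|] := boolP (fconnect f x p); last exact: (eq_at_of_chain fo fp fq).
have [xp'|] := boolP (fconnect f x p'); last exact: (eq_at_of_chain fo' fp' fq').
case: (fconnect_total xp xp') => /fconnect_image[//|]; rewrite ?fp ?fp'.
- by move=> ?; case: pp'.
- by move/(fconnect_fixed fo)/p'o.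
- by move/(fconnect_fixed fo')/po''.
Qed.

End Chains.

(** The witness is the pair q, q' of points of depth 2 over different points of
    depth 1. If g is the identity on c, p, p' then it fixes q and q', and if it
    sends q and q' to the same point it preserves the pair as well. Only the
    values of f remain. *)
Lemma cond_b_meet_irreducible f :
  acyclic f -> cond_b f -> meet_irreducible (Con1 f).
Proof.
move=> ac [con [c [p [q [p' [q' [uq fq fq' [fp' fp fc]]]]]]]].
have [pc p'c p'p] : [/\ p <> c, p' <> c & p' <> p].
  by elems; split; simple congruence.
have pp' : p <> p' by simple congruence.
apply: (@meet_irreducible_witness _ (block [:: q; q'])).
- exact: blocks_EqRel.
- by rewrite block2_Con1 fq fq'; apply/blockP=> ?; by_elems.
move=> g fg.
have [kg|kg] := boolP (block [:: q; q'] \in Con1 g); [by left | right].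
have {}kg : ~ (g q = g q' \/ g q \in [:: q; q'] /\ g q' \in [:: q; q']).
  by move/blockP; apply/negP; rewrite -block2_Con1.
have two := transfer_depth2_pair fg fc fp fq fp' fq' pc p'c.
case: (rigid_depth1 fg fc fp fp' pc p'c p'p) => [[gc gp gp']|[gp gp']].
  case: kg; right.
  rewrite (depth2_id fg fc fp fq fp' pc p'c p'p gc gp').
  rewrite (depth2_id fg fc fp' fq' fp p'c pc pp' gc gp).
  by split; member.
have H := depth2_const fg fc fp fq fp' pc p'c p'p gp'.
have H' := depth2_const fg fc fp' fq' fp p'c pc pp' gp.
have [gc gq gq'] : [/\ g c = c, g q = p & g q' = p'].
  case: two => [E|E|E]; try by [case: kg; left | case: kg; right].
  have {}kg : g q <> g q' by move=> E'; apply: kg; left.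
  by elems; split; simple congruence.
have only r : f r = r -> r = c.
  move=> fr; have [i [j]] := con r c.
  by rewrite !iter_fix.
suff -> : g = f by [].
apply: (eq_of_two_chains ac fg _ fc fp fq pc gq _ fc fp' fq' p'c gq') => //;
  try simple congruence.
by move=> r /only ->.
Qed.

(** The witness has the single nontrivial block q, c, c': the map f does not
    preserve it, but every iterate of f from the second on does. *)
Lemma cond_a_meet_irreducible f :
  acyclic f -> cond_a f -> meet_irreducible (Con1 f).
Proof.
move=> ac [c [p [q [c' [p' [q' [uq [fq fp fc] [fq' fp' fc']]]]]]]].
elems.
apply: (@meet_irreducible_witness _ (block [:: q; c; c'])).
- exact: block_EqRel.
- apply/block_Con1=> /(_ c (mem_head _ _)); rewrite fq fc => /blockP ?; by_elems.
move=> g fg.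
have [kg|kg] := boolP (block [:: q; c; c'] \in Con1 g); [by left | right].
have {}kg : ~ ((g q = g c \/ g q \in [:: q; c; c'] /\ g c \in [:: q; c; c']) /\
               (g q = g c' \/ g q \in [:: q; c; c'] /\ g c' \in [:: q; c; c'])).
  case=> /blockP E /blockP E'; case/block_Con1: kg => u us.
  by elems; subst u.
have roots u v : f u = u -> f v = v ->
    g u = g v \/ g u \in [:: u; v] /\ g v \in [:: u; v].
  by move=> fu fv; apply: (transfer_ideal fg); [closed | member | member].
have cc := roots c c' fc fc'.
(* The chains can be glued to each other with shift 0 or 1. *)
have pq' : [\/ g q = g q', g q \in [:: q; q'] /\ g q' \in [:: q; q'],
      g q \in [:: f q; f q'] /\ g q' \in [:: f q; f q']
    | g q \in [:: c; c'] /\ g q' \in [:: c; c']].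
  apply: (transfer_two_pairs fg); rewrite ?fq ?fq' ?fp ?fp'; try by [closed | member];
    by out.
have chain : g q = g c \/ g q \in [:: c; p; q] /\ g c \in [:: c; p; q].
  by apply: (transfer_ideal fg); [closed | member | member].
have chain' : g q' = g c' \/ g q' \in [:: c'; p'; q'] /\ g c' \in [:: c'; p'; q'].
  by apply: (transfer_ideal fg); [closed | member | member].
have edge : g p = g c \/ g p \in [:: c; p] /\ g c \in [:: c; p].
  by apply: (transfer_ideal fg); [closed | member | member].
have edge' : g p' = g c' \/ g p' \in [:: c'; p'] /\ g c' \in [:: c'; p'].
  by apply: (transfer_ideal fg); [closed | member | member].
have low : [\/ g q = g p', g q \in [:: q; p'] /\ g p' \in [:: q; p']
    | g q \in [:: p; c; c'] /\ g p' \in [:: p; c; c']].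
  apply: (transfer_pair fg); rewrite ?fq ?fp'; try by [closed | member];
    by out.
have low' : [\/ g q' = g p, g q' \in [:: q'; p] /\ g p \in [:: q'; p]
    | g q' \in [:: p'; c; c'] /\ g p \in [:: p'; c; c']].
  apply: (transfer_pair fg); rewrite ?fq' ?fp; try by [closed | member];
    by out.
have gcp : g c <> p.
  move=> E; have E' : g c' = p by move: cc; forget; by_elems.
  have q'E : g q' = p by move: chain'; forget; by_elems.
  have qE : g q = p by move: pq' chain; forget; by_elems.
  by apply: kg; split; left; simple congruence.
have gc'p' : g c' <> p'.
  move=> E; have E' : g c = p' by move: cc; forget; by_elems.
  have qE : g q = p' by move: chain; forget; by_elems.
  by apply: kg; split; left; simple congruence.
have in3 u : u = q \/ u = c \/ u = c' -> u \in [:: q; c; c'].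
  by case=> [|[]] ->; member.
have gqc : g q <> g c.
  move=> E; apply: kg; split; first by left.
  case: cc => [E'|[cD cD']]; first by left; rewrite E.
  right; split; apply: in3; [rewrite E; move: cD | move: cD']; rewrite !inE;
    by case/orP=> /eqP->; auto.
have gq : g q = p.
  have [//|/eqP gqp] := eqVneq (g q) p; case: kg.
  case: chain => // -[qD cD].
  have {}cD : g c = q \/ g c = c by forget; elems; auto.
  have {}qD : g q = q \/ g q = c by forget; elems; auto.
  have c'D : g c' = g c \/ g c' = c'.
    by move: cc cD qD; forget => *; elems; pick.
  have {}c'D : g c' = q \/ g c' = c \/ g c' = c' by case: c'D => [->|->]; [case: cD|]; auto.
  by split; right; split; apply: in3 => //; [case: qD | case: cD | case: qD]; auto.
have gq' : g q' = p'.
  have : g q' = p \/ g q' = p'.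
    by move: pq'; forget => *; elems; pick.
  case=> // E; have E' : g c' = p by move: chain'; forget; by_elems.
  by case: gcp; move: cc; forget; by_elems.
have [gc gc'] : g c = c /\ g c' = c'.
  by move: cc chain chain'; forget => *; elems; split; simple congruence.
have gp' : g p' = c' by move: low edge'; forget; by_elems.
have gp : g p = c by move: low' edge; forget; by_elems.
suff -> : g = f by [].
apply: (eq_of_two_chains ac fg _ fc fp fq _ gq gp fc' fp' fq' _ gq' gp') => //;
  try simple congruence.
move=> r fr; have := roots r c fr fc; have := roots r c' fr fc'.
by forget; by_elems.
Qed.


(** * Reducible congruence lattices *)

Lemma last_outside f (P : pred A) n x : ~~ P x -> P (iter n f x) ->
  exists y, [/\ fconnect f x y, ~~ P y & P (f y)].
Proof.
elim: n x => [|n IH] x; first by move/negPf->.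
move=> Px; rewrite iterSr; have [Pfx _|Pfx /(IH _ Pfx)[y [xy Py Pfy]]] := boolP (P (f x)).
  by exists x; rewrite connect0.
by exists y; split=> //; apply: connect_trans xy; apply: fconnect1.
Qed.

Lemma acyclic_chain f x : acyclic f -> f (f x) <> f x ->
  exists c p z, [/\ fconnect f x z, f z = p, f p = c, f c = c & p <> c].
Proof.
move=> ac /eqP ffx; have [n E] := ac x.
have [|z [xz Pz Pfz]] := @last_outside f (fun u => f (f u) == f u) n x ffx.
  by rewrite -/(iter n.+1 f x) -E; apply/eqP; apply/esym.
by exists (f (f z)), (f z), z; split=> //; [exact/eqP | move/esym/eqP; apply/negP].
Qed.

(** Keeping f on one side and sending the other side to the root c preserves
    all congruences of f: if x in the deep component is congruent to y outside, then
    a high iterate of f shows that c is congruent to f y. *)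
Lemma one_deep_component_reducible f c p z r :
    acyclic f -> f z = p -> f p = c -> f c = c -> p <> c -> f r = r -> r <> c ->
    (forall y, ~~ fconnect f y c -> f (f y) = f y) ->
  ~ meet_irreducible (Con1 f).
Proof.
move=> ac fz fp fc pc fr rc shallow irr.
pose g1 := [ffun y => if fconnect f y c then f y else c].
pose g2 := [ffun y => if fconnect f y c then c else f y].
have cf y : fconnect f (f y) c = fconnect f y c.
  apply/idP/idP=> [|/fconnect_image[<-|//]]; last by rewrite fc connect0.
  exact/connect_trans/fconnect1.
have key k x y : k \in EqRel A -> (forall x y, (x, y) \in k -> (f x, f y) \in k) ->
    (x, y) \in k -> fconnect f x c -> ~~ fconnect f y c -> (c, f y) \in k.
  move=> kE P xy /iter_findex xc yc.
  have /Con1_iter/(_ (findex f x c).+1 _ _ xy) : k \in Con1 f by apply/Con1P.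
  by rewrite iterS xc fc iterSr iter_fix ?shallow.
have pc' : fconnect f p c by rewrite -fp fconnect1.
have zc' : fconnect f z c by rewrite -cf fz.
have rc' : ~~ fconnect f r c by apply/negP=> /(fconnect_fixed fr) E; apply: rc.
apply: (meet_irreducible_split irr (g1 := g1) (g2 := g2)
          (k1 := block [:: r; p]) (k2 := block [:: z; c])).
- apply: Con1_sub => k kE P x y xy; rewrite !ffunE.
  have [R S T] := EqRelP _ kE.
  have [xc|xc] := boolP (fconnect f x c); have [yc|yc] := boolP (fconnect f y c).
  + exact: P.
  + exact: T _ _ _ (P _ _ xy) (S _ _ (key k x y kE P xy xc yc)).
  + exact: T _ _ _ (key k y x kE P (S _ _ xy) yc xc) (P _ _ xy).
  + exact: R.
- apply: Con1_sub => k kE P x y xy; rewrite !ffunE.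
  have [R S T] := EqRelP _ kE.
  have [xc|xc] := boolP (fconnect f x c); have [yc|yc] := boolP (fconnect f y c).
  + exact: R.
  + exact: (key k x y).
  + exact: S _ _ (key k y x kE P (S _ _ xy) yc xc).
  + exact: P.
- apply: Con1_subI => k kE P1 P2 x y xy.
  have [R S T] := EqRelP _ kE.
  move: (P1 _ _ xy) (P2 _ _ xy); rewrite !ffunE.
  by case: ifP => xc; case: ifP => yc // H1 H2;
    [exact: T _ _ _ H1 H2 | exact: T _ _ _ H2 H1].
- by rewrite block2_Con1 !ffunE (negPf rc') pc' fp; apply/blockP; left.
- rewrite block2_Con1 fr fp; apply/blockP=> ?; by_elems.
- by rewrite block2_Con1 !ffunE zc' connect0; apply/blockP; left.
- have zp : z <> p by congruence.
  rewrite block2_Con1 fz fc; apply/blockP=> ?; by_elems.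
Qed.


(** Here f is g2 after g1, where g1 only moves p to c and g2 sends all points
    other than c and p to p. *)
Lemma short_path_reducible f c p z :
    (forall y, f (f y) = c) -> f z = p -> p <> c ->
    (forall y, f y = c -> y = c \/ y = p) ->
  ~ meet_irreducible (Con1 f).
Proof.
move=> ff fz pc fib irr.
have fp : f p = c by rewrite -fz ff.
have fc : f c = c by rewrite -{1}fp ff.
have fE y : y <> c -> y <> p -> f y = p.
  by move=> yc yp; case: (fib _ (ff y)) => // /fib[].
pose g1 := [ffun y => if y == p then c else y].
pose g2 := [ffun y => if y \in [:: c; p] then y else p].
have key k x y : k \in EqRel A -> (forall x y, (x, y) \in k -> (f x, f y) \in k) ->
    (x, y) \in k -> x \in [:: c; p] -> y \notin [:: c; p] -> (c, p) \in k.
  move=> kE P /P; rewrite !inE negb_or => xy xcp /andP[/eqP yc /eqP yp].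
  by rewrite (fE y) // in xy; case/orP: xcp => /eqP E; move: xy; rewrite E ?fc ?fp.
have [zc zp] : z <> c /\ z <> p by split; congruence.
have zcp : z \notin [:: c; p] by out.
have pcp : p \in [:: c; p] by member.
apply: (meet_irreducible_split irr (g1 := g1) (g2 := g2)
          (k1 := block [:: c; z]) (k2 := block [:: p; z])).
- apply: Con1_sub => k kE P x y xy; rewrite !ffunE.
  have [R S T] := EqRelP _ kE.
  have kp u : u <> p -> (p, u) \in k -> (c, u) \in k.
    have [->|/eqP uc] := eqVneq u c; first by move=> *; apply: R.
    move=> up pu; have ucp : u \notin [:: c; p] by out.
    exact: T _ _ _ (key k p u kE P pu pcp ucp) pu.
  have [xp|/eqP xp] := eqVneq x p; have [yp|/eqP yp] := eqVneq y p => //.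
  + by apply: kp => //; rewrite -xp.
  + by apply/S/kp => //; apply: S; rewrite -yp.
- apply: Con1_sub => k kE P x y xy; rewrite !ffunE.
  have [R S T] := EqRelP _ kE.
  have kp u v : u \in [:: c; p] -> v \notin [:: c; p] -> (u, v) \in k -> (u, p) \in k.
    move=> ucp vcp uv; have cp := key k u v kE P uv ucp vcp.
    by elems; subst u; [exact: cp | exact: R].
  have [xc|xc] := boolP (x \in [:: c; p]); have [yc|yc] := boolP (y \in [:: c; p]) => //.
  + exact: (kp x y).
  + exact/S/(kp y x)/S.
- apply: Con1_subI => k kE P1 P2.
  have fg u : f u = g2 (g1 u).
    rewrite !ffunE; have [->|/eqP up] := eqVneq u p; first by rewrite fp mem_head.
    have [->|/eqP uc] := eqVneq u c; first by rewrite fc mem_head.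
    by rewrite fE // ifN //; out.
  by move=> x y /P1/P2; rewrite !fg.
- rewrite block2_Con1 !ffunE.
  rewrite (negPf (introN eqP (not_eq_sym pc))) (negPf (introN eqP zp)).
  by apply/blockP; right; split; member.
- rewrite block2_Con1 fz fc; apply/blockP=> ?; by_elems.
- by rewrite block2_Con1 !ffunE (negPf zcp) pcp; apply/blockP; left.
- rewrite block2_Con1 fz fp; apply/blockP=> ?; by_elems.
Qed.

(** A point x of depth at most 2 that is congruent to a point y of larger depth
    makes c congruent to p, because some iterate of f sends y to p and x to c.
    This is what both g1 and g2 need to preserve the congruences of f.
    Conversely, g1 and g2 together recover f: from c congruent to f y they yield
    c congruent to p by descending along the orbit of y. *)
Lemma single_branch_reducible f c p z :
    acyclic f -> (forall r, f r = r -> r = c) ->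
    f z = p -> f p = c -> f c = c -> p <> c ->
    (forall y, f (f y) = c -> f y <> c -> f y = p) ->
    (exists y, f (f y) <> c) ->
  ~ meet_irreducible (Con1 f).
Proof.
move=> ac root fz fp fc pc branch [t ht] irr.
pose low y := f (f y) == c.
pose g1 := [ffun y => if low y then f y else f (f y)].
pose g2 := [ffun y => if low y then c else f y].
have toroot y : exists n, iter n f y = c.
  have [r /root-> /iter_findex E] := acyclic_root ac y.
  by exists (findex f y c).
have [u [uhigh ulow]] : exists u, ~~ low u /\ low (f u).
  have [n tn] := toroot t.
  have [||u [_ uh ul]] := @last_outside f low n t; last by exists u.
    exact/eqP.
  by rewrite /low tn !fc.
have reach y : f y <> c -> exists n, iter n.+1 f y = p.
  have [n] := toroot y; elim: n y => [|n IH] y; first by move=> /= ->.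
  rewrite iterSr => yn fy; have [/eqP ffy|/eqP ffy] := boolP (f (f y) == c).
    by exists 0; apply: branch.
  by have [m E] := IH (f y) yn ffy; exists m.+1; rewrite iterSr.
have key k x y : k \in EqRel A -> (forall x y, (x, y) \in k -> (f x, f y) \in k) ->
    (x, y) \in k -> low x -> ~~ low y -> (c, p) \in k.
  move=> kE P xy /eqP xlow /eqP /reach[n E].
  have /Con1_iter/(_ n.+2 _ _ xy) : k \in Con1 f by apply/Con1P.
  by rewrite (iterSr n.+1 f y) E !iterSr xlow iter_fix.
have lowE x : low x -> f x = c \/ f x = p.
  by move/eqP=> E; have [|/eqP] := eqVneq (f x) c; auto.
apply: (meet_irreducible_split irr (g1 := g1) (g2 := g2)
          (k1 := block [:: u; f u]) (k2 := block [:: z; c])).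
- apply: Con1_sub => k kE P x y xy; rewrite !ffunE.
  have [R S T] := EqRelP _ kE.
  have mixed v w : (v, w) \in k -> low v -> ~~ low w -> (f v, f (f w)) \in k.
    move=> vw vl wh; have cp := key k v w kE P vw vl wh.
    have := P _ _ (P _ _ vw); rewrite (eqP vl) => cw.
    by case: (lowE v vl) => -> //; apply: T _ _ _ (S _ _ cp) cw.
  have [xl|xh] := boolP (low x); have [yl|yh] := boolP (low y).
  + exact: P.
  + exact: mixed.
  + by apply/S/mixed => //; apply: S.
  + exact/P/P.
- apply: Con1_sub => k kE P x y xy; rewrite !ffunE.
  have [R S T] := EqRelP _ kE.
  have mixed v w : (v, w) \in k -> low v -> ~~ low w -> (c, f w) \in k.
    move=> vw vl wh; have cp := key k v w kE P vw vl wh.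
    have fvw := P _ _ vw.
    by case: (lowE v vl) fvw => -> // ?; apply: T _ _ _ cp _.
  have [xl|xh] := boolP (low x); have [yl|yh] := boolP (low y).
  + exact: R.
  + exact: (mixed x).
  + by apply/S/(mixed y) => //; apply: S.
  + exact: P.
- apply: Con1_subI => k kE P1 P2.
  have [R S T] := EqRelP _ kE.
  have lowc : low c by rewrite /low !fc.
  have descend w : f w <> c -> (c, w) \in k -> (c, p) \in k.
    have [n] := toroot w; elim: n w => [|n IH] w; first by move=> /= ->; rewrite fc.
    rewrite iterSr => wn fw cw; have [wl|wh] := boolP (low w).
      by have := P1 _ _ cw; rewrite !ffunE lowc wl fc (branch w (eqP wl) fw).
    apply: (IH (f w) wn); first exact/eqP.
    by have := P2 _ _ cw; rewrite !ffunE lowc (negPf wh).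
  have mixed v w : (v, w) \in k -> low v -> ~~ low w -> (f v, f w) \in k.
    move=> vw vl wh.
    have cfw : (c, f w) \in k by have := P2 _ _ vw; rewrite !ffunE vl (negPf wh).
    case: (lowE v vl) => -> //.
    exact: T _ _ _ (S _ _ (descend (f w) (elimN eqP wh) cfw)) cfw.
  move=> x y xy; have [xl|xh] := boolP (low x); have [yl|yh] := boolP (low y).
  + by have := P1 _ _ xy; rewrite !ffunE xl yl.
  + exact: mixed.
  + by apply/S/mixed => //; apply: S.
  + by have := P2 _ _ xy; rewrite !ffunE (negPf xh) (negPf yh).
- rewrite block2_Con1 !ffunE (negPf uhigh) ulow.
  by apply/blockP; left.
- rewrite block2_Con1.
  have E : f (f u) = p by apply: branch; [exact/eqP | exact/eqP].
  have up : u <> p by move=> E'; case/eqP: uhigh; rewrite E' fp.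
  have fup : f u <> p by move=> E'; rewrite E' fp in E; apply: pc.
  rewrite E; apply/blockP=> ?; by_elems.
- rewrite block2_Con1 !ffunE /low fz fp fc eqxx; apply/blockP; left.
  by rewrite fc eqxx.
- have zp : z <> p by congruence.
  rewrite block2_Con1 fz fc; apply/blockP=> ?; by_elems.
Qed.

Lemma meet_irreducible_acyclic f : acyclic f -> meet_irreducible (Con1 f) ->
  [\/ type_I f, type_II f, cond_a f | cond_b f].
Proof.
move=> hf irr; have nt := meet_irreducible_nontrivial irr.
have [/forallP ff|] := boolP [forall x, f (f x) == f x].
  by constructor 1; split=> // x; apply/eqP/ff.
rewrite negb_forall => /existsP[x /eqP /(acyclic_chain hf)[c [p [z [_ fz fp fc pc]]]]].
have [/existsP[r /andP[/eqP fr /eqP rc]]|] := boolP [exists r, (f r == r) && (r != c)].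
  have [/forall_inP shallow|] :=
      boolP [forall (y | ~~ fconnect f y c), f (f y) == f y].
    have sh y (yc : ~~ fconnect f y c) : f (f y) = f y by exact/eqP/shallow.
    by case: (one_deep_component_reducible hf fz fp fc pc fr rc sh irr).
  rewrite negb_forall_in => /exists_inP[y yc /eqP].
  case/(acyclic_chain hf)=> c' [p' [z' [yz' fz' fp' fc' p'c']]].
  have cc' : c <> c'.
    move=> E; case/negP: yc; apply: connect_trans yz' _.
    by rewrite E -fp' -fz' (fconnect_iter f 2 z').
  constructor 3; exists c, p, z, c', p', z'; split=> //.
  by distinct.
rewrite negb_exists => /forallP nroot.
have root r : f r = r -> r = c.
  by move=> fr; apply/eqP; have := nroot r; rewrite fr eqxx negbK.
have con : connected f.
  move=> u v; have [ru /root-> /iter_findex uc] := acyclic_root hf u.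
  have [rv /root-> /iter_findex vc] := acyclic_root hf v.
  by exists (findex f u c), (findex f v c); rewrite uc vc.
have [/existsP[z' /and3P[/eqP fp' /eqP p'c /eqP p'p]]|] :=
    boolP [exists y, [&& f (f y) == c, f y != c & f y != p]].
  constructor 4; split=> //; exists c, p, z, (f z'), z'; split=> //.
  by distinct.
rewrite negb_exists => /forallP nbranch.
have branch y : f (f y) = c -> f y <> c -> f y = p.
  move=> ffy /eqP fy; apply/eqP; have := nbranch y.
  by rewrite ffy eqxx fy negbK.
have [/forallP ff|] := boolP [forall y, f (f y) == c]; last first.
  rewrite negb_forall => /existsP[t /eqP tc].
  by case: (single_branch_reducible hf root fz fp fc pc branch _ irr); exists t.
have {}ff y : f (f y) = c by apply/eqP.
case: (leqP 3 #|[set y | f y == f c]|) => [ge3|lt3].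
  by constructor 2; split=> //; exists c.
case: (short_path_reducible ff fz pc _ irr) => y fy.
have [|/eqP yc] := eqVneq y c; first by left.
have [|/eqP yp] := eqVneq y p; first by right.
have u3 : uniq [:: c; p; y].
  by distinct.
have sub : [:: c; p; y] \subset [set y | f y == f c].
  apply/subsetP=> u; rewrite !inE fc.
  by case/or3P=> /eqP->; rewrite ?fc ?fp ?fy.
by have := subset_leq_card sub; rewrite (card_uniqP u3) leqNgt lt3.
Qed.

End Theory.

Theorem theorem6p4 (A : finType) (hA : 3 <= #|A|) (f : {ffun A -> A})
    (hf : acyclic f) :
  meet_irreducible (Con1 f) <->
  [\/ type_I f, type_II f, cond_a f | cond_b f].
Proof.
split=> [|[]].
- exact: meet_irreducible_acyclic.
- exact: type_I_meet_irreducible.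
- exact: type_II_meet_irreducible.
- exact: cond_a_meet_irreducible.
- exact: cond_b_meet_irreducible.
Qed.
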